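(* Let $\mathcal{C}$ be a collection of $n \geq 2$ pairwise disjoint compact convex sets in the plane. Then there is a pair of distinct sets $A, B \in \mathcal{C}$ such that every line that separates $A$ from $B$ separates either $A$ or $B$ from a subcollection $\mathcal{F} \subseteq \mathcal{C}$ consisting of at least $\frac{n}{18}$ sets.
   Context: A line $l$ separates a set $X$ from a set $Y$ if $X$ and $Y$ lie in opposite closed half-planes determined by $l$. A line $l$ separates a set $X$ from a collection $\mathcal{F}$ of sets if $X$ lies in one closed half-plane determined by $l$ and every member of $\mathcal{F}$ lies in the opposite closed half-plane. *)

(* Defs.v *)
From mathcomp Require Import all_boot all_order all_algebra finmap.
From mathcomp Require Import all_classical all_reals all_analysis.

Set Implicit Arguments.
Unset Strict Implicit.
Unset Printing Implicit Defensive.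

Import Order.TTheory GRing.Theory Num.Theory numFieldNormedType.Exports.

Local Open Scope classical_set_scope.
Local Open Scope ring_scope.

Definition dot (R : realType) (u p : 'rV[R]_2) : R := \sum_i u 0 i * p 0 i.

Definition is_line (R : realType) (l : set 'rV[R]_2) : Prop :=
  exists (u : 'rV[R]_2) (c : R), u != 0 /\ l = [set p | dot u p = c].

(* Replacing (u, c) by (- u, - c) keeps l and exchanges H and H', so each
   side of l may play either role. *)
Definition opposite_halfplanes (R : realType) (l H H' : set 'rV[R]_2) : Prop :=
  exists (u : 'rV[R]_2) (c : R),
    [/\ u != 0, l = [set p | dot u p = c],
        H = [set p | dot u p <= c] & H' = [set p | c <= dot u p]].

Definition separates (R : realType) (l X Y : set 'rV[R]_2) : Prop :=
  exists H H' : set 'rV[R]_2,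
    [/\ opposite_halfplanes l H H', X `<=` H & Y `<=` H'].

Definition separates_from_collection (R : realType) (l X : set 'rV[R]_2)
    (F : {fset set 'rV[R]_2}) : Prop :=
  exists H H' : set 'rV[R]_2,
    [/\ opposite_halfplanes l H H', X `<=` H
      & forall Y : set 'rV[R]_2, Y \in F -> Y `<=` H'].

(* Main.v *)
(* Suppose that every pair of sets has a separator with fewer than n/18 sets on either
   closed side.  One such separator, taken as the x-axis, is crossed by at least
   16q + 1 sets, where q = (n - 1) %/ 18; number them from left to right along it.
   The separator of the i-th and j-th sets meets the x-axis between them.  If l > j
   and the l-th set is not on the right of this separator, it crosses it on a definite
   side of the x-axis; write (l | ij) for that side, and likewise if l < i.  Then, for
   i < j < l < n, (i | ln) = (n | ij) and (j | ln) <> (l | ij).  For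
   a0 < a1 < a2 < a3 < c1 < c2 < c3 < c4 this is contradictory:
     (c2 | a1 a2) = (a1 | c1 c2) = (a1 | c1 c3)     both <> (c1 | a0 a1)
       = (c3 | a1 a3) = (c3 | a2 a3)                both <> (a3 | c3 c4)
       = (a2 | c2 c3) <> (c2 | a1 a2).
   Each of these eight crossings can fail for at most q - 1 sets on the side in
   question, so when the a's and the c's range over blocks of four consecutive sets of
   the left and the right half, some choice has all eight crossings. *)

Require Import Defs.
From mathcomp Require Import all_boot all_order all_algebra finmap.
From mathcomp Require Import all_classical all_reals all_analysis.
From mathcomp Require Import ring lra zify.
Import Order.TTheory GRing.Theory Num.Theory numFieldNormedType.Exports.

Local Open Scope classical_set_scope.
Local Open Scope ring_scope.

(** * Sides of the axis on which separators are crossed *)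

Lemma signed_gt0 (R : realDomainType) (y : R) :
  y != 0 -> exists e : bool, 0 < (-1) ^+ e * y.
Proof.
case/lt_total/orP => hy; last by exists false; rewrite mul1r.
by exists true; rewrite mulN1r oppr_gt0.
Qed.

(* A set left of [x + f * y = p] (with [p <= q]) and a set right of [x + g * y = q],
   each crossing the other line, do so on the same side of the x-axis: the sign of
   [y] at either crossing point is the sign of [g - f]. *)
Lemma same_side (R : realFieldType) (f p g q vx vy wx wy : R) (d e : bool) :
  p <= q -> 0 < (-1) ^+ d * vy -> 0 < (-1) ^+ e * wy ->
  vx + f * vy <= p -> q < vx + g * vy ->
  wx + f * wy < p -> q <= wx + g * wy ->
  d = e.
Proof.
move=> pq hv hw v1 v2 w1 w2.
have {}v1 : 0 < (g - f) * vy by lra.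
have {}w1 : 0 < (g - f) * wy by lra.
by case: d e hv hw => -[]; rewrite ?mul1r ?mulN1r // => hv hw; exfalso; nra.
Qed.

(* If [d = e], then [v] is no farther from the x-axis than the point where the first
   two lines meet, but farther than the point where the last two meet; for [w] it is
   the other way round. *)
Lemma opposite_sides (R : realFieldType)
    (f p h r g q vx vy wx wy : R) (d e : bool) :
  p <= r -> r <= q -> 0 < (-1) ^+ d * vy -> 0 < (-1) ^+ e * wy ->
  p <= vx + f * vy -> vx + h * vy <= r -> q < vx + g * vy ->
  wx + f * wy < p -> r <= wx + h * wy -> wx + g * wy <= q ->
  d = ~~ e.
Proof.
move=> pr rq hv hw v1 v2 v3 w1 w2 w3.
have a1 : (h - f) * vy <= r - p by lra.
have a2 : q - r < (g - h) * vy by lra.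
have a3 : r - p < (h - f) * wy by lra.
have a4 : (g - h) * wy <= q - r by lra.
case: d e hv hw => -[]; rewrite ?mul1r ?mulN1r // => hv hw; exfalso.
- have hf : h - f < 0 by nra.
  have gh : g - h < 0 by nra.
  have : vy > wy by rewrite -(ltr_nM2l hf); lra.
  have : vy < wy by rewrite -(ltr_nM2l gh); lra.
  by lra.
- have hf : 0 < h - f by nra.
  have gh : 0 < g - h by nra.
  have : vy < wy by rewrite -(ltr_pM2l hf); lra.
  have : vy > wy by rewrite -(ltr_pM2l gh); lra.
  by lra.
Qed.

(** * Counting in grids and windows *)

(** Double counting: if no cell vanished, the grid total would be at least [M * N], but the row and
    column bounds keep it at most [M * a + N * b]. *)
Lemma exists_zero_cell (M N a b : nat) (P Q : nat -> nat -> nat) :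
  (forall r, (r < M)%N -> (\sum_(t < N) P r t <= a)%N) ->
  (forall t, (t < N)%N -> (\sum_(r < M) Q r t <= b)%N) ->
  (M * a + N * b < M * N)%N ->
  exists r t, [/\ (r < M)%N, (t < N)%N & (P r t + Q r t = 0)%N].
Proof.
move=> hP hQ hlt.
suff /existsP[r /existsP[t /eqP rt0]] :
    [exists r : 'I_M, [exists t : 'I_N, (P r t + Q r t == 0)%N]] by exists r, t.
rewrite -[X in is_true X]negbK; apply/negP => /existsPn nz.
move: hlt; rewrite ltnNge => /negP; apply.
have -> : (M * N = \sum_(r < M) \sum_(t < N) 1)%N.
  by rewrite !sum_nat_const !card_ord muln1.
apply: (@leq_trans (\sum_(r < M) \sum_(t < N) (P r t + Q r t))).
  apply: leq_sum => r _; apply: leq_sum => t _.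
  by have /existsPn/(_ t) := nz r; rewrite -lt0n.
under eq_bigr do rewrite big_split.
rewrite big_split /= leq_add //.
  have -> : (M * a = \sum_(r < M) a)%N by rewrite sum_nat_const card_ord.
  by apply: leq_sum => r _; exact: hP.
rewrite exchange_big /=.
have -> : (N * b = \sum_(t < N) b)%N by rewrite sum_nat_const card_ord.
by apply: leq_sum => t _; exact: hQ.
Qed.

(** The inequality is strict because [j] is counted by [Q] but lies outside the window. In use, [j]
    is one of the two separated sets, which always lies on its own side. *)
Lemma sum_nth_lt_count (T : Type) (z : T) (Q : pred T) (s : seq T)
    (o N j : nat) :
  (o + N <= size s)%N -> (j < size s)%N -> (j < o)%N || (o + N <= j)%N ->
  Q (nth z s j) ->
  (\sum_(t < N) Q (nth z s (o + t)%N) < count Q s)%N.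
Proof.
move=> oN js joN Qj.
pose Q' k := Q (nth z s k).
have -> : (\sum_(t < N) Q (nth z s (o + t)%N) = count Q' (iota o N))%N.
  rewrite -(addn0 o) iotaDl count_map -sumn_count -[N in iota _ N]subn0.
  rewrite sumnE big_map -/(index_iota 0 N) big_mkord.
  by apply: eq_bigr => t _; rewrite addn0.
have -> : count Q s = count Q' (iota 0 (size s)).
  by rewrite -[in LHS](mkseq_nth z s) count_map.
rewrite -!size_filter.
have -> : (size (seq.filter Q' (iota o N))).+1 = size (j :: seq.filter Q' (iota o N)).
  by [].
apply: uniq_leq_size => /=.
  rewrite filter_uniq ?iota_uniq // andbT mem_filter mem_iota.
  by apply/negP => /andP[_]; lia.
move=> k; rewrite inE => /predU1P[->|]; rewrite !mem_filter !mem_iota.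
  by rewrite /Q' Qj add0n js.
by move=> /andP[-> ?] /=; lia.
Qed.

(** * The contradictory cycle of crossings *)

(** On the axis, a point of [X] has abscissa at least [r >= c >= p], so a point of [X] strictly left
    of the first line is off the axis and has a side. *)
Lemma far_right_sign (R : realType) (V : Type) (x y : V -> R) (X : set V)
    (f p h r c : R) :
  p <= c -> c <= r -> (forall v, X v -> r <= x v + h * y v) ->
  ~ (X `<=` [set v | p <= x v + f * y v]) ->
  exists (e : bool) v, [/\ X v, x v + f * y v < p & 0 < (-1) ^+ e * y v].
Proof.
move=> pc cr hX /existsNP[v /not_implyP[Xv /negP]]; rewrite -ltNge => hv.
have [|e he] := @signed_gt0 _ (y v); last by exists e, v.
by apply/eqP => y0; have := hX v Xv; rewrite y0 in hv *; lra.
Qed.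

Lemma far_left_sign (R : realType) (V : Type) (x y : V -> R) (X : set V)
    (f p h r c : R) :
  c <= p -> r <= c -> (forall v, X v -> x v + h * y v <= r) ->
  ~ (X `<=` [set v | x v + f * y v <= p]) ->
  exists (e : bool) v, [/\ X v, p < x v + f * y v & 0 < (-1) ^+ e * y v].
Proof.
move=> pc cr hX /existsNP[v /not_implyP[Xv /negP]]; rewrite -ltNge => hv.
have [|e he] := @signed_gt0 _ (y v); last by exists e, v.
by apply/eqP => y0; have := hX v Xv; rewrite y0 in hv *; lra.
Qed.

Lemma eight_transversals_absurd (R : realType) (V : Type) (x y : V -> R)
    (m : nat) (X : nat -> set V) (b : nat -> R) (h p : nat -> nat -> R)
    (a0 a1 a2 a3 c1 c2 c3 c4 : nat) :
  (forall i j, (i < j)%N -> (j < m)%N -> b i <= p i j /\ p i j <= b j) ->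
  (forall i j, (i < j)%N -> (j < m)%N ->
    X i `<=` [set v | x v + h i j * y v <= p i j]) ->
  (forall i j, (i < j)%N -> (j < m)%N ->
    X j `<=` [set v | p i j <= x v + h i j * y v]) ->
  (a0 < a1)%N -> (a1 < a2)%N -> (a2 < a3)%N -> (a3 < c1)%N ->
  (c1 < c2)%N -> (c2 < c3)%N -> (c3 < c4)%N -> (c4 < m)%N ->
  (forall i j l, (i, j, l) \in [:: (a1, a2, c2); (a2, a3, c3); (a1, a3, c3);
      (a0, a1, c1)] ->
    ~ (X l `<=` [set v | p i j <= x v + h i j * y v])) ->
  (forall i j l, (i, j, l) \in [:: (c1, c2, a1); (c2, c3, a2); (c1, c3, a1);
      (c3, c4, a3)] ->
    ~ (X l `<=` [set v | x v + h i j * y v <= p i j])) ->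
  False.
Proof.
move=> hb hL hR a01 a12 a23 ac c12 c23 c34 c4m nR nL.
have c3m := ltn_trans c34 c4m; have c2m := ltn_trans c23 c3m.
have c1m := ltn_trans c12 c2m; have a3m := ltn_trans ac c1m.
have a2m := ltn_trans a23 a3m; have a1m := ltn_trans a12 a2m.
have a13 := ltn_trans a12 a23; have c13 := ltn_trans c12 c23.
have a3c2 := ltn_trans ac c12; have a3c3 := ltn_trans ac c13.
have a2c1 := ltn_trans a23 ac; have a2c2 := ltn_trans a23 a3c2.
have a2c3 := ltn_trans a23 a3c3; have a1c1 := ltn_trans a12 a2c1.
have a1c2 := ltn_trans a12 a2c2; have a1c3 := ltn_trans a12 a2c3.
(* The side (l | ij) is a relation with [e], where [false] means above the axis; [same] and
   [opposite] below hold for all witnessing points. *)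
pose right_sign i j l (e : bool) :=
  exists v, [/\ X l v, x v + h i j * y v < p i j & 0 < (-1) ^+ e * y v].
pose left_sign i j l (e : bool) :=
  exists v, [/\ X l v, p i j < x v + h i j * y v & 0 < (-1) ^+ e * y v].
have rightE i j l : (i < j)%N -> (j < l)%N -> (l < m)%N ->
    (i, j, l) \in [:: (a1, a2, c2); (a2, a3, c3); (a1, a3, c3); (a0, a1, c1)] ->
    exists e, right_sign i j l e.
  move=> ij jl lm /nR nr; have [_ pj] := hb _ _ ij (ltn_trans jl lm).
  have [jp _] := hb _ _ jl lm.
  exact: far_right_sign pj jp (hR _ _ jl lm) nr.
have leftE i j l : (l < i)%N -> (i < j)%N -> (j < m)%N ->
    (i, j, l) \in [:: (c1, c2, a1); (c2, c3, a2); (c1, c3, a1); (c3, c4, a3)] ->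
    exists e, left_sign i j l e.
  move=> li ij jm /nL nl; have [ip _] := hb _ _ ij jm.
  have [_ pi] := hb _ _ li (ltn_trans ij jm).
  exact: far_left_sign ip pi (hL _ _ li (ltn_trans ij jm)) nl.
have same i j l n e e' : (i < j)%N -> (j < l)%N -> (l < n)%N -> (n < m)%N ->
    left_sign l n i e -> right_sign i j n e' -> e = e'.
  move=> ij jl ln nm [v [Xv v1 v2]] [w [Xw w1 w2]].
  have lm := ltn_trans ln nm; have jm := ltn_trans jl lm.
  have [_ pj] := hb _ _ ij jm; have [bj bl] := hb _ _ jl lm.
  have [lp _] := hb _ _ ln nm.
  have pq : p i j <= p l n by lra.
  exact: same_side pq v2 w2 (hL _ _ ij jm _ Xv) v1 w1 (hR _ _ ln nm _ Xw).
have opposite i j l n e e' : (i < j)%N -> (j < l)%N -> (l < n)%N -> (n < m)%N ->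
    left_sign l n j e -> right_sign i j l e' -> e = ~~ e'.
  move=> ij jl ln nm [v [Xv v1 v2]] [w [Xw w1 w2]].
  have lm := ltn_trans ln nm; have jm := ltn_trans jl lm.
  have [_ pj] := hb _ _ ij jm; have [bj bl] := hb _ _ jl lm.
  have [lp _] := hb _ _ ln nm.
  exact: opposite_sides (le_trans pj bj) (le_trans bl lp) v2 w2
    (hR _ _ ij jm _ Xv) (hL _ _ jl lm _ Xv) v1 w1 (hR _ _ jl lm _ Xw)
    (hL _ _ ln nm _ Xw).
have [|e1 E1] := rightE _ _ _ a12 a2c2 c2m; first by rewrite !inE eqxx.
have [|e2 E2] := rightE _ _ _ a23 a3c3 c3m; first by rewrite !inE eqxx ?orbT.
have [|e3 E3] := rightE _ _ _ a13 a3c3 c3m; first by rewrite !inE eqxx ?orbT.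
have [|e4 E4] := rightE _ _ _ a01 a1c1 c1m; first by rewrite !inE eqxx ?orbT.
have [|e5 E5] := leftE _ _ _ a1c1 c12 c2m; first by rewrite !inE eqxx ?orbT.
have [|e6 E6] := leftE _ _ _ a2c2 c23 c3m; first by rewrite !inE eqxx ?orbT.
have [|e7 E7] := leftE _ _ _ a1c1 c13 c3m; first by rewrite !inE eqxx ?orbT.
have [|e8 E8] := leftE _ _ _ a3c3 c34 c4m; first by rewrite !inE eqxx ?orbT.
(* These close a cycle with five negations: [e1 = e5 = ~~ e4 = e7 = e3 = ~~ e8 = e2 = e6 = ~~
   e1]. *)
have := same _ _ _ _ _ _ a12 a2c1 c12 c2m E5 E1.
have := same _ _ _ _ _ _ a13 ac c13 c3m E7 E3.
have := same _ _ _ _ _ _ a23 a3c2 c23 c3m E6 E2.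
have := opposite _ _ _ _ _ _ a12 a2c2 c23 c3m E6 E1.
have := opposite _ _ _ _ _ _ a01 a1c1 c12 c2m E5 E4.
have := opposite _ _ _ _ _ _ a01 a1c1 c13 c3m E7 E4.
have := opposite _ _ _ _ _ _ a13 a3c3 c34 c4m E8 E3.
have := opposite _ _ _ _ _ _ a23 a3c3 c34 c4m E8 E2.
clear; by case: e1 e2 e3 e4 e5 e6 e7 e8 => -[] [] [] [] [] [] [].
Qed.

Lemma transversal_family_absurd (R : realType) (V : Type) (x y : V -> R)
    (k : nat) (s : seq (set V)) (b : nat -> R) (h p : nat -> nat -> R) :
  (16 * k + 16 < size s)%N ->
  (forall i j, (i < j)%N -> (j < size s)%N -> b i <= p i j /\ p i j <= b j) ->
  (forall i j, (i < j)%N -> (j < size s)%N ->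
    nth set0 s i `<=` [set v | x v + h i j * y v <= p i j]) ->
  (forall i j, (i < j)%N -> (j < size s)%N ->
    nth set0 s j `<=` [set v | p i j <= x v + h i j * y v]) ->
  (forall i j, (i < j)%N -> (j < size s)%N ->
    (count (fun X => `[< X `<=` [set v | (x v + h i j * y v <= p i j)%R] >]) s
      <= k.+1)%N) ->
  (forall i j, (i < j)%N -> (j < size s)%N ->
    (count (fun X => `[< X `<=` [set v | (p i j <= x v + h i j * y v)%R] >]) s
      <= k.+1)%N) ->
  False.
Proof.
move=> sz hb hL hR cL cR.
pose lam i j l : bool :=
  `[< nth set0 s l `<=` [set v | x v + h i j * y v <= p i j] >].
pose rho i j l : bool :=
  `[< nth set0 s l `<=` [set v | p i j <= x v + h i j * y v] >].
(* The right half starts at [o]. With [r < 8 * k + 5] and [t < 8 * k + 6], the blocks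
   [r, ..., r + 3] and [o + t, ..., o + t + 3] stay below [o] and [size s] respectively. *)
pose o := (8 * k + 8)%N.
have rhoB i j u N : (i < j)%N -> (j < u)%N -> (u + N <= size s)%N ->
    (\sum_(t < N) rho i j (u + t) <= k)%N.
  move=> ij ju uN.
  have js : (j < size s)%N by apply: leq_trans ju (leq_trans (leq_addr _ _) uN).
  rewrite -ltnS; apply: leq_trans (cR i j ij js).
  apply: (@sum_nth_lt_count _ set0
    (fun Y => `[< Y `<=` [set v | p i j <= x v + h i j * y v] >]) s u N j) => //.
    by rewrite ju.
  by apply/asboolP; exact: hR.
have lamB i j u N : (i < j)%N -> (j < size s)%N -> (u + N <= i)%N ->
    (\sum_(t < N) lam i j (u + t) <= k)%N.
  move=> ij js uN; have ils := ltn_trans ij js.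
  rewrite -ltnS; apply: leq_trans (cL i j ij js).
  apply: (@sum_nth_lt_count _ set0
    (fun Y => `[< Y `<=` [set v | x v + h i j * y v <= p i j] >]) s u N i) => //.
  - exact: leq_trans uN (ltnW ils).
  - by rewrite uN orbT.
  - by apply/asboolP; exact: hL.
(* [P] and [Q] count the failures among the eight crossings. For fixed [r] the separators in [P] are
   fixed while the tested set runs through a window; the same holds for [Q] with [t] fixed. *)
pose P r t := (rho (1 + r) (2 + r) (o + 1 + t) + rho (2 + r) (3 + r) (o + 2 + t)
  + rho (1 + r) (3 + r) (o + 2 + t) + rho (0 + r) (1 + r) (o + 0 + t))%N.
pose Q r t := (lam (o + 0 + t) (o + 1 + t) (1 + r)
  + lam (o + 1 + t) (o + 2 + t) (2 + r) + lam (o + 0 + t) (o + 2 + t) (1 + r)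
  + lam (o + 2 + t) (o + 3 + t) (3 + r))%N.
have four : (4 * k = k + k + k + k)%N by clear; lia.
have [r [t [rM tN]]] : exists r t,
    [/\ (r < 8 * k + 5)%N, (t < 8 * k + 6)%N & (P r t + Q r t = 0)%N].
  apply: (@exists_zero_cell _ _ (4 * k) (4 * k)); last by clear; nia.
  - move=> r rM; rewrite !big_split /= four.
    by rewrite !leq_add //; apply: rhoB; move: sz rM; rewrite /o; clear; lia.
  - move=> t tN; rewrite !big_split /= four.
    by rewrite !leq_add //; apply: lamB; move: sz tN; rewrite /o; clear; lia.
move=> /eqP; rewrite /P /Q !addn_eq0 !eqb0 -!andbA.
case/and5P=> n1 n2 n3 n4 /and4P[n5 n6 n7 n8].
apply: (@eight_transversals_absurd R V x y (size s) (nth set0 s) b h p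
  (0 + r) (1 + r) (2 + r) (3 + r) (o + 0 + t) (o + 1 + t) (o + 2 + t)
  (o + 3 + t)) => //;
  try (by move: sz rM tN; rewrite /o; clear; lia).
- by move=> i j l; rewrite !inE => /or4P[] /eqP[-> -> ->]; apply/asboolPn.
- by move=> i j l; rewrite !inE => /or4P[] /eqP[-> -> ->]; apply/asboolPn.
Qed.

(** * Coordinates adapted to a line *)

Lemma dotE (R : realType) (u v : 'rV[R]_2) :
  dot u v = u 0 0 * v 0 0 + u 0 1 * v 0 1.
Proof.
rewrite /dot !big_ord_recl big_ord0 addr0.
by rewrite (_ : lift ord0 ord0 = 1) //; exact: val_inj.
Qed.

(** The dot product with [u] turned by a right angle: a coordinate along the lines on which [dot u]
    is constant. *)
Definition abscissa (R : realType) (u v : 'rV[R]_2) : R :=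
  u 0 1 * v 0 0 - u 0 0 * v 0 1.
Arguments abscissa {R} u v.

Lemma sum_sqr_row_gt0 (R : realType) (u : 'rV[R]_2) :
  u != 0 -> 0 < u 0 0 ^+ 2 + u 0 1 ^+ 2.
Proof.
move=> u0; rewrite lt_neqAle addr_ge0 ?sqr_ge0 // andbT eq_sym.
apply: contra u0; rewrite paddr_eq0 ?sqr_ge0 // !sqrf_eq0 => /andP[/eqP h0 /eqP h1].
apply/eqP/rowP => i; rewrite mxE.
by have [->|->] : i = 0 \/ i = 1 by case: i => -[|[|//]] ?; [left|right]; exact: val_inj.
Qed.

(** The linear map given by [abscissa u] and [dot u] has determinant equal to the squared length of
    [u]. *)
Lemma abscissa_dot_inj (R : realType) (u v w : 'rV[R]_2) :
  u != 0 -> abscissa u v = abscissa u w -> dot u v = dot u w -> v = w.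
Proof.
move=> /sum_sqr_row_gt0 u0 hx hy.
have e0 : (u 0 0 ^+ 2 + u 0 1 ^+ 2) * (v 0 0 - w 0 0) = 0.
  have -> : (u 0 0 ^+ 2 + u 0 1 ^+ 2) * (v 0 0 - w 0 0) =
      u 0 1 * (abscissa u v - abscissa u w) + u 0 0 * (dot u v - dot u w).
    by rewrite /abscissa !dotE; ring.
  by rewrite hx hy !subrr !mulr0 addr0.
have e1 : (u 0 0 ^+ 2 + u 0 1 ^+ 2) * (v 0 1 - w 0 1) = 0.
  have -> : (u 0 0 ^+ 2 + u 0 1 ^+ 2) * (v 0 1 - w 0 1) =
      u 0 1 * (dot u v - dot u w) - u 0 0 * (abscissa u v - abscissa u w).
    by rewrite /abscissa !dotE; ring.
  by rewrite hx hy !subrr !mulr0 subr0.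
move/eqP: e0; rewrite mulf_eq0 gt_eqF //= subr_eq0 => /eqP e0.
move/eqP: e1; rewrite mulf_eq0 gt_eqF //= subr_eq0 => /eqP e1.
apply/rowP => i.
by have [->|->] : i = 0 \/ i = 1 by case: i => -[|[|//]] ?; [left|right]; exact: val_inj.
Qed.

Lemma convex_meets_line (R : realType) (A : set 'rV[R]_2) (u v w : 'rV[R]_2)
    (c : R) :
  convex_set A -> A v -> A w -> dot u v < c -> c < dot u w ->
  exists e, A e /\ dot u e = c.
Proof.
move=> cA Av Aw vc cw.
pose t := (dot u w - c) / (dot u w - dot u v).
have d0 : 0 < dot u w - dot u v by lra.
have t0 : 0 <= t by rewrite divr_ge0 //; lra.
have t1 : t <= 1 by rewrite ler_pdivrMr // mul1r; lra.
exists (t *: v + (1 - t) *: w); split.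
  by have := cA v w (Itv01 t0 t1); rewrite !inE => /(_ Av Aw).
have -> : dot u (t *: v + (1 - t) *: w) = t * dot u v + (1 - t) * dot u w.
  by rewrite !dotE !mxE; ring.
have : t * (dot u w - dot u v) = dot u w - c by rewrite /t divfK // gt_eqF.
by move=> ?; lra.
Qed.

(* In the coordinates given by [abscissa u] and [dot u - c], the separator of two
   sets crossed by [dot u = c] is a graph over the second coordinate. *)
Lemma transversal_separator (R : realType) (u w : 'rV[R]_2) (c d : R)
    (A B : set 'rV[R]_2) (eA eB : 'rV[R]_2) :
  u != 0 -> w != 0 ->
  A `<=` [set v | dot w v <= d] -> B `<=` [set v | d <= dot w v] ->
  A eA -> B eB -> dot u eA = c -> dot u eB = c -> abscissa u eA < abscissa u eB ->
  ~ (A `<=` [set v | dot u v <= c]) -> ~ (A `<=` [set v | c <= dot u v]) ->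
  exists h p, [/\ abscissa u eA <= p, p <= abscissa u eB,
    forall v, (dot w v <= d) = (abscissa u v + h * (dot u v - c) <= p)
    & forall v, (d <= dot w v) = (p <= abscissa u v + h * (dot u v - c))].
Proof.
move=> /sum_sqr_row_gt0; set N := _ + _ => N0 w0 Ad Bd AeA BeB yA yB xAB nl nr.
pose al := (w 0 0 * u 0 1 - w 0 1 * u 0 0) / N.
pose de := (w 0 0 * u 0 0 + w 0 1 * u 0 1) / N.
have wE v : dot w v = al * abscissa u v + de * dot u v.
  by rewrite /al /de /abscissa !dotE /N; field; rewrite gt_eqF.
have hA : al * abscissa u eA + de * c <= d by have := Ad _ AeA; rewrite /= wE yA.
have hB : d <= al * abscissa u eB + de * c by have := Bd _ BeB; rewrite /= wE yB.
have al0 : 0 <= al.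
  by rewrite -(pmulr_lge0 _ (_ : 0 < abscissa u eB - abscissa u eA)); lra.
have {al0} al0 : 0 < al.
  (* If [al = 0], the separator is the line [dot u v = c] itself, and [A] would lie on one side of
     it. *)
  rewrite lt_neqAle al0 andbT; apply/eqP => alE.
  rewrite -alE in hA hB wE.
  have dE : d = de * c by lra.
  have : de != 0.
    apply: contra w0 => /eqP de0; apply/eqP/rowP => i; rewrite mxE.
    have := wE w; rewrite de0 !mul0r addr0 dotE -!expr2 => /eqP.
    rewrite paddr_eq0 ?sqr_ge0 // !sqrf_eq0 => /andP[/eqP h0 /eqP h1].
    by have [->|->] : i = 0 \/ i = 1
      by case: i => -[|[|//]] ?; [left|right]; exact: val_inj.
  case/lt_total/orP => de0.
  - apply: nr => v Av; have := Ad _ Av; rewrite /= wE dE mul0r add0r.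
    by rewrite ler_nM2l.
  - apply: nl => v Av; have := Ad _ Av; rewrite /= wE dE mul0r add0r.
    by rewrite ler_pM2l.
have E v : dot w v - d =
    al * (abscissa u v + de / al * (dot u v - c) - (d - de * c) / al).
  by rewrite wE; field; rewrite gt_eqF.
exists (de / al), ((d - de * c) / al); split.
- by rewrite ler_pdivlMr // mulrC; lra.
- by rewrite ler_pdivrMr // mulrC; lra.
- by move=> v; rewrite -subr_le0 E pmulr_rle0 // subr_le0.
- by move=> v; rewrite -subr_ge0 E pmulr_rge0 // subr_ge0.
Qed.

(** * Reduction to the sets crossing one separator *)

Theorem theorem2 (R : realType) (n : nat) (C : {fset set 'rV[R]_2})
    (n_ge2 : (2 <= n)%N)
    (cardC : #|` C| = n)
    (compactC : forall X : set 'rV[R]_2, X \in C -> compact X)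
    (convexC : forall X : set 'rV[R]_2, X \in C -> convex_set X)
    (disjC : trivIset [set` C] id) :
  exists A B : set 'rV[R]_2,
    [/\ A \in C, B \in C, A != B
      & forall l : set 'rV[R]_2, is_line l -> separates l A B ->
        exists F : {fset set 'rV[R]_2},
          [/\ (F `<=` C)%fset,
              n%:R / 18 <= #|` F|%:R :> R
            & separates_from_collection l A F \/
              separates_from_collection l B F]].
Proof.
apply: contrapT => no.
pose members (H : set 'rV[R]_2) := [fset X in C | `[< (X `<=` H)%classic >]]%fset.
have membersP H X : (X \in members H) = (X \in C) && `[< X `<=` H >].
  by rewrite !inE.
pose lo (w : 'rV[R]_2) d := [set v | dot w v <= d].
pose hi (w : 'rV[R]_2) d := [set v | d <= dot w v].
(* [q] is the largest integer below n/18, so more than [q] sets means at least n/18 sets. *)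
pose q := (n.-1 %/ 18)%N.
(* A pair without any separator would satisfy the conclusion vacuously, so [no] also yields that a
   separator exists. If the side of [A] is large, its sets are separated from [B], and vice
   versa. *)
have sep A B : A \in C -> B \in C -> A != B -> exists (w : 'rV[R]_2) (d : R),
    [/\ w != 0, A `<=` lo w d, B `<=` hi w d,
      (#|` members (lo w d)| <= q)%N
      & (#|` members (hi w d)| <= q)%N].
  move=> AC BC AB; apply: contrapT => nsep; apply: no; exists A, B; split=> //.
  move=> l _ [_ [_ [[w [d [w0 -> -> ->]]] Ad Bd]]].
  have large H : ~ (#|` members H| <= q)%N -> n%:R / 18 <= #|` members H|%:R :> R.
    by rewrite ler_pdivrMr // -natrM ler_nat /q; clear; lia.
  have subC H : (members H `<=` C)%fset.
    by apply/fsubsetP => X; rewrite membersP => /andP[].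
  have [small1|/negP/large large1] :=
      boolP (#|` members (lo w d)| <= q)%N; last first.
    exists (members (lo w d)); split=> //; right.
    exists (hi w d), (lo w d); split=> //.
      exists (- w), (- d); rewrite oppr_eq0.
      have dotN v : dot (- w) v = - dot w v by rewrite !dotE !mxE !mulNr opprD.
      split=> //; apply/seteqP; split=> v /=; rewrite dotN ?lerN2 //.
        by move->.
      by move/oppr_inj.
    by move=> Y; rewrite membersP => /andP[_ /asboolP].
  have [small2|/negP/large large2] :=
      boolP (#|` members (hi w d)| <= q)%N; last first.
    exists (members (hi w d)); split=> //; left.
    exists (lo w d), (hi w d); split=> //.
      by exists w, d.
    by move=> Y; rewrite membersP => /andP[_ /asboolP].
  by case: nsep; exists w, d.
have count_members (s : seq (set 'rV[R]_2)) H : uniq s -> {subset s <= C} ->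
    (count (fun X => `[< (X `<=` H)%classic >]) s <= #|` members H|)%N.
  move=> us sC; rewrite -size_filter; apply: uniq_leq_size.
    by rewrite filter_uniq.
  by move=> X; rewrite mem_filter membersP => /andP[-> /sC ->].
have [A0 [B0 [A0C B0C AB0]]] : exists A B, [/\ A \in C, B \in C & A != B].
  have : C != fset0 by rewrite -cardfs_gt0 cardC (leq_trans _ n_ge2).
  case/fset0Pn => A AC; have : (C `\ A)%fset != fset0.
    by rewrite -cardfs_gt0; move: n_ge2; rewrite -cardC (cardfsD1 A) AC.
  case/fset0Pn => B; rewrite !inE => /andP[BA BC]; exists A, B.
  by split=> //; rewrite eq_sym.
have [u [c [u0 A0c B0c qL qR]]] := sep _ _ A0C B0C AB0.
pose y v := dot u v - c.
pose sideL X := `[< X `<=` lo u c >].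
pose sideR X := `[< X `<=` hi u c >].
(* Positivity makes [q] the successor of [q.-1], the value later given to [k]. *)
have q0 : (0 < q)%N.
  apply: leq_trans qR; rewrite cardfs_gt0; apply/fset0Pn; exists B0.
  by rewrite membersP B0C; apply/asboolP.
pose crossing := predC (predU sideL sideR).
have /choice[e he] (X : set 'rV[R]_2) :
    exists v, X \in C -> crossing X -> X v /\ dot u v = c.
  have [XC|] := boolP (X \in C); last by exists 0.
  have [|nX] := boolP (crossing X); last by exists 0.
  rewrite /crossing /= negb_or => /andP[/asboolPn nl /asboolPn nr].
  move: nl nr => /existsNP[w /not_implyP[Xw /negP]]; rewrite -ltNge => cw.
  move=> /existsNP[v /not_implyP[Xv /negP]]; rewrite -ltNge => vc.
  have [e [Xe ec]] := convex_meets_line _ _ _ _ _ _ (convexC _ XC) Xv Xw vc cw.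
  by exists e.
pose base X := abscissa u (e X).
pose s := sort (fun X Y => base X <= base Y) (seq.filter crossing C).
have sP X : (X \in s) = crossing X && (X \in C) by rewrite mem_sort mem_filter.
have us : uniq s by rewrite sort_uniq filter_uniq ?fset_uniq.
have sC : {subset s <= C} by move=> X; rewrite sP => /andP[].
(* At most [2 * q] of the [n >= 18 * q + 1] sets lie on one side of the axis. *)
have sz : (16 * q < size s)%N.
  have := count_predC (predU sideL sideR) C.
  have := count_predUI sideL sideR C.
  have := count_members C (lo u c) (fset_uniq _) (fun _ => id).
  have := count_members C (hi u c) (fset_uniq _) (fun _ => id).
  rewrite size_sort size_filter -/sideL -/sideR -/crossing cardC.
  by move: qL qR n_ge2; rewrite /q; clear; lia.
pose b i := base (nth set0 s i).
have bmono i j : (i < j)%N -> (j < size s)%N -> b i < b j.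
  move=> ij js; have ils := ltn_trans ij js.
  have sorted_s : sorted (fun X Y => base X <= base Y) s.
    by apply: sort_sorted => X Y; exact: le_total.
  rewrite lt_neqAle (sorted_ltn_nth _ _ sorted_s) ?inE // ?andbT; last first.
    by move=> X Y Z; exact: le_trans.
  (* Equal abscissas on the axis give a common point of two members of [C], which then coincide by
     disjointness. *)
  apply/eqP => bij; have := nth_uniq set0 ils js us; rewrite (ltn_eqF ij).
  have /andP[cri iC] : crossing (nth set0 s i) && (nth set0 s i \in C).
    by rewrite -sP mem_nth.
  have /andP[crj jC] : crossing (nth set0 s j) && (nth set0 s j \in C).
    by rewrite -sP mem_nth.
  have [ei yi] := he _ iC cri; have [ej yj] := he _ jC crj.
  move/eqP; apply; apply: disjC => //; exists (e (nth set0 s i)); split => //.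
  by rewrite (abscissa_dot_inj _ _ _ _ u0 bij) // yi yj.
have /choice[hp hhp] (ij : nat * nat) : exists hp : R * R,
    (ij.1 < ij.2)%N -> (ij.2 < size s)%N -> [/\ b ij.1 <= hp.2 /\ hp.2 <= b ij.2,
      nth set0 s ij.1 `<=` [set v | abscissa u v + hp.1 * y v <= hp.2],
      nth set0 s ij.2 `<=` [set v | hp.2 <= abscissa u v + hp.1 * y v],
      (#|` members [set v | (abscissa u v + hp.1 * y v <= hp.2)%R]| <= q)%N
      & (#|` members [set v | (hp.2 <= abscissa u v + hp.1 * y v)%R]| <= q)%N].
  case: ij => i j /=.
  have [/andP[ij js]|nij] := boolP ((i < j)%N && (j < size s)%N); last first.
    (* A dummy value for pairs of indices that are out of order or out of range. *)
    by exists (0, 0) => ij js; move: nij; rewrite ij js.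
  have ils := ltn_trans ij js.
  have /andP[cri iC] : crossing (nth set0 s i) && (nth set0 s i \in C).
    by rewrite -sP mem_nth.
  have /andP[crj jC] : crossing (nth set0 s j) && (nth set0 s j \in C).
    by rewrite -sP mem_nth.
  have [ei yi] := he _ iC cri; have [ej yj] := he _ jC crj.
  have [|w [d [w0 wi wj wL wR]]] := sep _ _ iC jC.
    by rewrite nth_uniq // ltn_eqF.
  move: cri; rewrite /crossing /= negb_or => /andP[/asboolPn nl /asboolPn nr].
  have [h [p [pi pj EL ER]]] := transversal_separator _ _ _ _ _ _ _ _ _
    u0 w0 wi wj ei ej yi yj (bmono _ _ ij js) nl nr.
  have EL' : lo w d = [set v | abscissa u v + h * y v <= p].
    by apply/seteqP; split=> v; rewrite /lo /= EL.
  have ER' : hi w d = [set v | p <= abscissa u v + h * y v].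
    by apply/seteqP; split=> v; rewrite /hi /= ER.
  by exists (h, p) => _ _ /=; rewrite -EL' -ER'.
pose h i j := (hp (i, j)).1; pose p i j := (hp (i, j)).2.
apply: (@transversal_family_absurd _ _ (abscissa u) y q.-1 s b h p).
- by move: sz q0; clear; lia.
- by move=> i j ij js; have [] := hhp (i, j) ij js.
- by move=> i j ij js; have [] := hhp (i, j) ij js.
- by move=> i j ij js; have [] := hhp (i, j) ij js.
- move=> i j ij js; rewrite prednK //; apply: leq_trans (count_members _ _ us sC) _.
  by have [] := hhp (i, j) ij js.
- move=> i j ij js; rewrite prednK //; apply: leq_trans (count_members _ _ us sC) _.
  by have [] := hhp (i, j) ij js.
Qed.
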